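(* Let $\dot x=Bx+s$ be an autonomous compartmental system with $d$ pools satisfying the standing assumptions in the context, let $x^*=-B^{-1}s$ be its equilibrium, let $X^*=\operatorname{diag}(x_1^*,\dots,x_d^* )$, and let $\bar a^*=-(X^* )^{-1}B^{-1}X^*(1,\dots,1)^T$ be the equilibrium of the associated mean age equation. Let $\beta=(\beta_1,\dots,\beta_d)^T$ and $\eta=(\eta_1,\dots,\eta_d)^T$ with $\beta_i=\frac{s_i}{\sum_{j=1}^d s_j}$ and $\eta_i=\frac{x_i^*}{\sum_{j=1}^d x_j^*}$. Then the transit time $R_t$ with respect to the equilibrium solution $t\mapsto(x^*,\bar a^* )$ does not depend on time and is given by $$R=-(1,\dots,1)B^{-1}\beta,$$ and the mean age $M_t$ of mass with respect to this solution is given by $$M=-(1,\dots,1)B^{-1}\eta.$$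
   Context: Autonomous compartmental system: $\dot x=Bx+s$ with $B=(b_{ij})\in\mathbb{R}^{d\times d}$ invertible, $0\ne s\in[0,\infty)^d$, $b_{ii}<0$ for all $i$, $b_{ij}\ge0$ for $i\ne j$, and $\sum_{i=1}^d b_{ij}\le0$ for all $j$. Standing assumptions: for some $m\ge1$ and positive integers $d_1,\dots,d_m$ with $\sum_k d_k=d$, $B=(B_{kl})_{k,l\in\{1,\dots,m\}}$ is lower block triangular with blocks $B_{kl}\in\mathbb{R}^{d_k\times d_l}$, $B_{kl}=0$ for $k<l$, and there is $\delta>0$ such that: for each $n$ and each $i\in\{1,\dots,d_n\}$, $(B_{nn})_{ii}<0$, $(B_{nn})_{ij}\ge0$ for $j\ne i$, and $\sum_{j=1}^{d_n}(B_{nn})_{ij}\le-\delta$; $s_i\ge\delta$ for $i\in\{1,\dots,d_1\}$; and for all $n\in\{2,\dots,m\}$ and $i\in\{1+\sum_{k=1}^{n-1}d_k,\dots,\sum_{k=1}^{n}d_k\}$ there is $j\in\{1,\dots,\sum_{k=1}^{n-1}d_k\}$ with $b_{ij}\ge\delta$. The equilibrium $x^*=-B^{-1}s$ has positive entries. Mean age equation associated with a solution $x(t)$ with positive entries: $\dot{\bar a}_i=1+\frac{\sum_{j=1}^d(\bar a_j-\bar a_i)b_{ij}x_j(t)-\bar a_is_i}{x_i(t)}$, $i\in\{1,\dots,d\}$. Transit time and mean age: for a solution $(x_1(t),\dots,x_d(t),\bar a_1(t),\dots,\bar a_d(t))$ of the combined system consisting of $\dot x=Bx+s$ and the mean age equation,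 $$R_t:=\frac{\sum_{i=1}^d\bar a_i(t)x_i(t)\sum_{j=1}^d b_{ji}}{\sum_{i=1}^d x_i(t)\sum_{j=1}^d b_{ji}},\qquad M_t:=\frac{\sum_{i=1}^d\bar a_i(t)x_i(t)}{\sum_{i=1}^d x_i(t)}.$$ *)

(* Defs.v *)
From HB Require Import structures.
From mathcomp Require Import all_boot all_order all_algebra.
From mathcomp Require Import all_classical all_reals all_analysis.
Import Order.TTheory GRing.Theory Num.Theory.
Import numFieldNormedType.Exports.

Set Implicit Arguments.
Unset Strict Implicit.
Unset Printing Implicit Defensive.

Local Open Scope ring_scope.

Record compartmental (R : realType) (d : nat) (B : 'M[R]_d) (s : 'cV[R]_d) :
    Prop := Compartmental {
  comp_unit : B \in unitmx;
  comp_input_neq0 : s != 0;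
  comp_input_ge0 : forall i, 0 <= s i 0;
  comp_diag_lt0 : forall i, B i i < 0;
  comp_offdiag_ge0 : forall i j, i != j -> 0 <= B i j;
  comp_colsum_le0 : forall j, \sum_i B i j <= 0
}.

(* Block indices start at 0, so the first block is the one whose index has
   value 0. The row sums in block_rowsum range over a diagonal block only. *)
Record block_conditions (R : realType) (m : nat) (p : 'I_m -> nat)
    (B : 'M[R]_(\sum_(k < m) p k)) (s : 'cV[R]_(\sum_(k < m) p k))
    (delta : R) : Prop := BlockConditions {
  block_lower_triangular :
    forall k l : 'I_m, (k < l)%N -> submxblock B k l = 0;
  block_diag_lt0 :
    forall (n : 'I_m) (i : 'I_(p n)), submxblock B n n i i < 0;
  block_offdiag_ge0 :
    forall (n : 'I_m) (i j : 'I_(p n)), j != i -> 0 <= submxblock B n n i j;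
  block_rowsum :
    forall (n : 'I_m) (i : 'I_(p n)),
      \sum_(j < p n) submxblock B n n i j <= - delta;
  block_first_input :
    forall n : 'I_m, nat_of_ord n = 0%N ->
      forall i : 'I_(p n), delta <= submxcol s n i 0;
  block_later_input :
    forall n : 'I_m, (0 < n)%N -> forall i : 'I_(p n),
      exists (l : 'I_m) (j : 'I_(p l)),
        (l < n)%N /\ delta <= submxblock B n l i j
}.

Definition standing_assumptions (R : realType) (d : nat)
    (B : 'M[R]_d) (s : 'cV[R]_d) : Prop :=
  exists (m : nat) (p : 'I_m -> nat) (delta : R)
         (dE : d = (\sum_(k < m) p k)%N),
    [/\ (1 <= m)%N, forall k, (0 < p k)%N, 0 < delta &
        block_conditions (castmx (dE, dE) B) (castmx (dE, erefl 1%N) s) delta].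

Definition mean_age_rhs (R : realType) (d : nat) (B : 'M[R]_d)
    (s x a : 'cV[R]_d) (i : 'I_d) : R :=
  1 + (\sum_j (a j 0 - a i 0) * B i j * x j 0 - a i 0 * s i 0) / x i 0.

Record combined_solution (R : realType) (d : nat) (B : 'M[R]_d)
    (s : 'cV[R]_d) (x a : R -> 'cV[R]_d) : Prop := CombinedSolution {
  csol_pos : forall t i, 0 < x t i 0;
  csol_mass : forall (t : R) i,
    is_derive t (1 : R) (fun u : R => x u i 0) ((B *m x t + s) i 0);
  csol_age : forall (t : R) i,
    is_derive t (1 : R) (fun u : R => a u i 0) (mean_age_rhs B s (x t) (a t) i)
}.

Definition transit_time (R : realType) (d : nat) (B : 'M[R]_d)
    (x a : R -> 'cV[R]_d) (t : R) : R :=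
  (\sum_i a t i 0 * x t i 0 * \sum_j B j i) /
  (\sum_i x t i 0 * \sum_j B j i).

Definition mean_age_of_mass (R : realType) (d : nat)
    (x a : R -> 'cV[R]_d) (t : R) : R :=
  (\sum_i a t i 0 * x t i 0) / (\sum_i x t i 0).

Definition mass_equilibrium (R : realType) (d : nat) (B : 'M[R]_d)
    (s : 'cV[R]_d) : 'cV[R]_d := - (invmx B *m s).

(* The diagonal matrix X is invertible only because the mass equilibrium has
   positive entries, so that invmx X is a genuine inverse. *)
Definition age_equilibrium (R : realType) (d : nat) (B : 'M[R]_d)
    (s : 'cV[R]_d) : 'cV[R]_d :=
  let X := diag_mx (mass_equilibrium B s)^T in
  - (invmx X *m invmx B *m X *m const_mx 1).

Definition normalize (R : realType) (d : nat) (v : 'cV[R]_d) : 'cV[R]_d :=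
  \col_i (v i 0 / \sum_j v j 0).

(* Main.v *)
Require Import Defs.
From mathcomp Require Import all_boot all_order all_algebra.
From mathcomp Require Import all_classical all_reals all_analysis.
From mathcomp Require Import ring.
Import Order.TTheory GRing.Theory Num.Theory.
Local Open Scope ring_scope.

(** Write [x] for the mass equilibrium and [y_i = x_i a_i] for the equilibrium
    ages weighted by mass. Then [B x = - s] and [B y = - x], and every claim
    follows from these two linear identities once the entries of [x] are known
    to be positive. Positivity is a minimum principle applied block after block:
    if the earlier blocks of [x] are positive and [i] minimizes [x] over the
    current block with [x_i <= 0], then every contribution to
    [(B x)_i + s_i = 0] is nonnegative, and the input into [i] is positive. *)

Lemma block_triangular_positive (R : realType) (d : nat) (B : 'M[R]_d)
    (s x : 'cV[R]_d) (block : 'I_d -> nat) :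
  (forall i j, (block i < block j)%N -> B i j = 0) ->
  (forall i j, i != j -> 0 <= B i j) ->
  (forall i, \sum_(j | block j == block i) B i j <= 0) ->
  (forall i, 0 <= s i 0) ->
  (forall i, block i = 0%N -> 0 < s i 0) ->
  (forall i, (0 < block i)%N -> exists2 j, (block j < block i)%N & 0 < B i j) ->
  B *m x = - s ->
  forall i, 0 < x i 0.
Proof.
move=> Btri Boff Bsum s0 sfirst slater Bx i.
have [n] := ubnP (block i); elim: n i => // n IHn i ltin.
case: (@arg_minP _ _ _ i (fun j => block j == block i) (fun j => x j 0) (eqxx _)) => k /eqP ki kmin.
apply: lt_le_trans (kmin i (eqxx _)); rewrite ltNge; apply/negP => xk_le0.
have earlier j : (block j < block k)%N -> 0 < x j 0.
  by rewrite ki => ltjk; apply: IHn; apply: leq_trans ltjk _.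
have earlier_ge0 j : (block j < block k)%N -> 0 <= B k j * x j 0.
  move=> ltjk; apply: mulr_ge0; last exact/ltW/earlier.
  by apply: Boff; apply: contraTneq ltjk => ->; rewrite ltnn.
(* Split [x j 0] as [(x j 0 - x k 0) + x k 0]. The differences are nonnegative by minimality and the
   one at [j = k] vanishes, so the negative diagonal entry does no harm; what remains is the block
   row sum times [x k 0], both nonpositive. *)
have block_ge0 : 0 <= \sum_(j | block j == block k) B k j * x j 0.
  have -> : \sum_(j | block j == block k) B k j * x j 0 =
      \sum_(j | block j == block k) B k j * (x j 0 - x k 0) +
      (\sum_(j | block j == block k) B k j) * x k 0.
    by rewrite mulr_suml -big_split; apply: eq_bigr => j _ /=; ring.
  apply: addr_ge0; last by apply: mulr_le0; first exact: Bsum.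
  apply: sumr_ge0 => j; rewrite ki => bj.
  have [->|kj] := eqVneq k j; first by rewrite subrr mulr0.
  by rewrite mulr_ge0 ?Boff // subr_ge0 kmin.
have later_eq0 : \sum_(j | block j != block k) B k j * x j 0 =
    \sum_(j | (block j < block k)%N) B k j * x j 0.
  rewrite (bigID (fun j => block j < block k)%N) /= [X in _ + X]big1 ?addr0.
    by apply: eq_bigl => j; case: ltngtP.
  by move=> j; case: ltngtP => // ltkj _; rewrite Btri ?mul0r.
have : (B *m x) k 0 + s k 0 = 0 by rewrite Bx mxE addNr.
rewrite mxE (bigID (fun j => block j == block k)) /= later_eq0.
apply/eqP; rewrite gt_eqF //.
(* The strict sign comes from [s k 0] in the first block, and from the inflow [B k j * x j 0] out of
   an earlier pool [j] in the others. *)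
have [k0|k_gt0] := posnP (block k).
  by rewrite ltr_wpDl ?sfirst // addr_ge0 // sumr_ge0.
rewrite ltr_wpDr // ltr_wpDl //.
have [j ltjk Bkj] := slater k k_gt0.
rewrite (bigD1 j) //= ltr_wpDr ?mulr_gt0 ?earlier //.
by apply: sumr_ge0 => l /andP[ltlk _]; apply: earlier_ge0.
Qed.

(** [tagnat.rank] is a bijection from pairs (block, position) to flat indices. This carries the
    row-sum bound for a diagonal block over to the flat matrix. *)
Lemma big_tagnat_block (R : nmodType) (m : nat) (p : 'I_m -> nat) (n : 'I_m)
    (F : 'I_(\sum_(k < m) p k) -> R) :
  \sum_(i | tagnat.sig1 i == n) F i = \sum_(j < p n) F (tagnat.Rank n j).
Proof.
rewrite (reindex tagnat.rank) /=; last exact/onW_bij/tagnat.rank_bij.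
transitivity (\sum_(k | k == n) \sum_(j < p k) F (tagnat.Rank k j)).
  rewrite sig_big_dep /=; apply: eq_big => [[k j]|[k j] _] //=.
  by rewrite tagnat.Rank1K andbT.
by rewrite big_pred1_eq.
Qed.

Lemma mass_equilibriumP (R : realType) (d : nat) (B : 'M[R]_d) (s : 'cV[R]_d) :
  B \in unitmx -> B *m mass_equilibrium B s = - s.
Proof. by move=> uB; rewrite mulmxN mulKVmx. Qed.

Lemma mass_equilibrium_gt0 (R : realType) (d : nat) (B : 'M[R]_d)
    (s : 'cV[R]_d) :
  compartmental B s -> standing_assumptions B s ->
  forall i, 0 < mass_equilibrium B s i 0.
Proof.
move=> [uB _ s0 _ Boff _] [m [p [delta [dE [_ _ d0 blk]]]]].
(* Once [d] is literally the sum of the block sizes, both casts are identities. *)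
subst d; rewrite !castmx_id in blk.
case: blk => Btri _ _ Bsum sfirst slater.
have BE (i j : 'I_(\sum_(k < m) p k)) : B i j =
    submxblock B (tagnat.sig1 i) (tagnat.sig1 j) (tagnat.sig2 i) (tagnat.sig2 j).
  by rewrite mxE !tagnat.sig2K.
apply: (@block_triangular_positive _ _ B s _ (fun i => tagnat.sig1 i)) => //.
- by move=> i j ltij; rewrite BE Btri ?mxE.
- move=> i; rewrite (eq_bigl (fun j => tagnat.sig1 j == tagnat.sig1 i)) //.
  rewrite big_tagnat_block.
  apply: le_trans (_ : - delta <= 0); last by rewrite oppr_le0 ltW.
  apply: le_trans (Bsum _ (tagnat.sig2 i)).
  by apply: ler_sum => j _; rewrite mxE tagnat.sig2K.
- move=> i i0; apply: lt_le_trans d0 _.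
  by have := sfirst _ i0 (tagnat.sig2 i); rewrite mxE tagnat.sig2K.
- move=> i /slater /(_ (tagnat.sig2 i)) [l [j [ltl dB]]].
  exists (tagnat.Rank l j); first by rewrite tagnat.Rank1K.
  by apply: lt_le_trans d0 _; move: dB; rewrite mxE tagnat.sig2K.
- exact: mass_equilibriumP.
Qed.

(** The diagonal matrix is invertible, its determinant being a product of positive entries, so it
    cancels its inverse; applied to the all-ones vector it returns the mass equilibrium. *)
Lemma age_equilibriumP (R : realType) (d : nat) (B : 'M[R]_d) (s : 'cV[R]_d) :
  (forall i, 0 < mass_equilibrium B s i 0) ->
  diag_mx (mass_equilibrium B s)^T *m age_equilibrium B s
  = - (invmx B *m mass_equilibrium B s).
Proof.
move=> x0; set x := mass_equilibrium B s.
have uX : diag_mx x^T \in unitmx.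
  rewrite unitmxE det_diag unitfE; apply/prodf_neq0 => i _.
  by rewrite mxE gt_eqF ?x0.
rewrite mulmxN -!mulmxA mulKVmx //; congr (- (_ *m _)).
by apply/colP => i; rewrite mul_diag_mx !mxE mulr1.
Qed.

Lemma sum_col (R : pzSemiRingType) (d : nat) (v : 'cV[R]_d) :
  \sum_i v i 0 = (const_mx 1 *m v : 'M[R]_1) 0 0.
Proof. by rewrite mxE; apply: eq_bigr => i _; rewrite mxE mul1r. Qed.

Lemma mul_normalize (R : realType) (d : nat) (u : 'rV[R]_d) (v : 'cV[R]_d) :
  (u *m normalize v) 0 0 = (u *m v) 0 0 / \sum_j v j 0.
Proof.
by rewrite !mxE mulr_suml; apply: eq_bigr => i _; rewrite mxE mulrA.
Qed.

Theorem proposition1 (R : realType) (d : nat) (B : 'M[R]_d) (s : 'cV[R]_d)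
    (hcomp : compartmental B s) (hstand : standing_assumptions B s) :
  let xs : 'cV[R]_d := mass_equilibrium B s in
  let as_ : 'cV[R]_d := age_equilibrium B s in
  let x : R -> 'cV[R]_d := fun _ => xs in
  let a : R -> 'cV[R]_d := fun _ => as_ in
  let beta : 'cV[R]_d := normalize s in
  let eta : 'cV[R]_d := normalize xs in
  let ones : 'rV[R]_d := const_mx 1 in
  [/\ combined_solution B s x a,
      forall t : R, transit_time B x a t = (- (ones *m invmx B *m beta)) 0 0 &
      forall t : R, mean_age_of_mass x a t = (- (ones *m invmx B *m eta)) 0 0].
Proof.
move=> xs as_ x a beta eta ones.
have uB := comp_unit hcomp.
have xs0 : forall i, 0 < xs i 0 by exact: mass_equilibrium_gt0.
have Bxs : B *m xs = - s by exact: mass_equilibriumP.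
pose ys := diag_mx xs^T *m as_.
have ysE i : ys i 0 = as_ i 0 * xs i 0 by rewrite /ys mul_diag_mx !mxE mulrC.
have ys_inv : ys = - (invmx B *m xs) by exact: age_equilibriumP.
have Bys : B *m ys = - xs by rewrite ys_inv mulmxN mulKVmx.
(* Exchanging the sums removes the column-sum weights from the transit time: [v = xs] gives minus
   the total of [s], and [v = ys] minus the total of [xs]. *)
have colsum (v : 'cV[R]_d) : \sum_i v i 0 * \sum_j B j i = \sum_j (B *m v) j 0.
  under eq_bigr do rewrite mulr_sumr.
  rewrite exchange_big; apply: eq_bigr => j _; rewrite mxE.
  by apply: eq_bigr => i _; rewrite mulrC.
have entryN (v : 'M[R]_1) : (- v) 0 0 = - v 0 0 by rewrite mxE.
split=> [|t|t].
- split=> [t i|t i|t i]; first exact: xs0.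
    by rewrite Bxs addNr [X in is_derive _ _ _ X]mxE; apply: is_derive_cst.
  suff -> : mean_age_rhs B s (x t) (a t) i = 0 by exact: is_derive_cst.
  (* Collecting the terms with factor [as_ i 0] exposes the mass balance, which is zero; the rest is
     [(B *m ys) i 0 = - xs i 0], so the right-hand side is [1 - 1]. *)
  have -> : mean_age_rhs B s (x t) (a t) i =
      1 + ((B *m ys) i 0 - as_ i 0 * ((B *m xs) i 0 + s i 0)) / xs i 0.
    rewrite /mean_age_rhs /x /a; congr (1 + _ / _).
    rewrite mulrDr opprD addrA; congr (_ - _).
    rewrite !mxE mulr_sumr -sumrB; apply: eq_bigr => j _.
    by rewrite ysE; ring.
  rewrite Bys Bxs [(- xs) i 0]mxE [(- s) i 0]mxE addNr mulr0 subr0 mulNr.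
  by rewrite divff ?subrr // gt_eqF.
(* Both sides reduce to the total of [xs] over the total of [s], since [invmx B *m s] is [- xs]. *)
- rewrite /transit_time /x /a colsum Bxs.
  under eq_bigr do rewrite -ysE.
  rewrite colsum Bys entryN mul_normalize.
  rewrite !sum_col !mulmxN -mulmxA.
  by rewrite !entryN invrN mulrNN -mulNr.
- rewrite /mean_age_of_mass /x /a.
  under eq_bigr do rewrite -ysE.
  rewrite sum_col entryN mul_normalize ys_inv mulmxN entryN -mulNr.
  by rewrite -/ones mulmxA.
Qed.
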